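(* Let $(h_k)_{k\ge0}$ be the Fibonacci sequence ($h_0=0$, $h_1=1$, $h_k=h_{k-1}+h_{k-2}$ for $k\ge2$) and let $n$ be a positive even integer. (i) There exist primes $p$ and $q$ such that $\dfrac{h_n}{h_{n-1}}<\dfrac{\log q}{\log p}<\dfrac{h_{n+1}}{h_n}$. (ii) If $p$ and $q$ are primes satisfying the inequalities in (i) and $\alpha=p^{h_{n+1}}/q^{h_n}$, then the characteristic transformation of $\alpha$ is the $2\times(n+1)$ matrix $$T_\alpha=\begin{pmatrix}h_1&h_2&\cdots&h_{n+1}\\ h_0&h_1&\cdots&h_n\end{pmatrix}.$$
   Context: $\mathbb N_0=\{0,1,2,\dots\}$, $\mathcal N=\{(a,b)\in\mathbb N_0^2:(a,b)\neq(0,0)\}$, $\mathcal G=\{(a,b)\in\mathcal N:\gcd(a,b)=1\}$ (convention $\gcd(a,0)=a$; $a/0=\infty$ for $a\in\mathbb N$). For positive irrational $\xi$: $\mathcal U(\xi)=\{(a,b)\in\mathcal N:a>b\xi\}$, $\mathcal L(\xi)=\{(a,b)\in\mathcal N:a<b\xi\}$, $\mathcal U_1(\xi)=\{(a,b)\in\mathcal U(\xi): a/b=\min\{m/n:(m,n)\in\mathcal U(\xi),\ m\le a\}\}$, $\mathcal L_2(\xi)=\{(a,b)\in\mathcal L(\xi): a/b=\max\{m/n:(m,n)\in\mathcal L(\xi),\ n\le b\}\}$; upper (resp. lower) best approximations for $\xi$ are elements of $\mathcal G\cap\mathcal U_1(\xi)$ (resp. $\mathcal G\cap\mathcal L_2(\xi)$).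 Characteristic transformation: for primes $p<q$, $\xi=\log q/\log p$, $(a,b)$ an upper or lower best approximation for $\xi$ and $\alpha=p^a/q^b$, let $(a_1,b_1),\dots,(a_N,b_N)$ be the complete list of upper or lower best approximations to $\xi$ with $a_k\le a$ and $b_k\le b$, ordered so that $b_1\le\dots\le b_N$ and $a_k\le a_{k+1}$ whenever $b_k=b_{k+1}$. Then $T_\alpha:\mathbb R^N\to\mathbb R^2$ is the linear map whose matrix has rows $(a_1,\dots,a_N)$ and $(b_1,\dots,b_N)$. *)

(* Defs.v *)
From HB Require Import structures.
From mathcomp Require Import all_boot all_order all_algebra.
From mathcomp Require Import all_classical all_reals all_analysis.
Set Implicit Arguments.
Unset Strict Implicit.
Unset Printing Implicit Defensive.
Import Order.TTheory GRing.Theory Num.Theory.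
Local Open Scope classical_set_scope.
Local Open Scope ring_scope.

Fixpoint fib (n : nat) : nat :=
  match n with
  | 0 => 0
  | 1 => 1
  | (m.+1 as k).+1 => fib k + fib m
  end%N.

Definition calN : set (nat * nat) := [set x | x <> (0%N, 0%N)].

Definition calG : set (nat * nat) := [set x | calN x /\ gcdn x.1 x.2 = 1%N].

(* The quotient a/b of a pair (a, b) <> (0, 0), with a/0 = +oo. *)
Definition quot (R : realType) (x : nat * nat) : \bar R :=
  if x.2 == 0%N then +oo%E else (x.1%:R / x.2%:R)%:E.

Definition calU (R : realType) (xi : R) : set (nat * nat) :=
  [set x | calN x /\ x.2%:R * xi < x.1%:R].

Definition calL (R : realType) (xi : R) : set (nat * nat) :=
  [set x | calN x /\ x.1%:R < x.2%:R * xi].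

Definition is_min (R : realType) (A : set (\bar R)) (r : \bar R) : Prop :=
  A r /\ lbound A r.

Definition is_max (R : realType) (A : set (\bar R)) (r : \bar R) : Prop :=
  A r /\ ubound A r.

Definition calU1 (R : realType) (xi : R) : set (nat * nat) :=
  [set x | calU xi x /\
    is_min [set quot R y | y in [set y | calU xi y /\ (y.1 <= x.1)%N]]
           (quot R x)].

Definition calL2 (R : realType) (xi : R) : set (nat * nat) :=
  [set x | calL xi x /\
    is_max [set quot R y | y in [set y | calL xi y /\ (y.2 <= x.2)%N]]
           (quot R x)].

Definition upper_best_approx (R : realType) (xi : R) : set (nat * nat) :=
  calG `&` calU1 xi.

Definition lower_best_approx (R : realType) (xi : R) : set (nat * nat) :=
  calG `&` calL2 xi.

Definition best_approx (R : realType) (xi : R) : set (nat * nat) :=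
  upper_best_approx xi `|` lower_best_approx xi.

Definition best_le (x y : nat * nat) : bool :=
  ((x.2 <= y.2) && ((x.2 == y.2) ==> (x.1 <= y.1)))%N.

Definition is_best_list (R : realType) (xi : R) (a b : nat)
    (s : seq (nat * nat)) : Prop :=
  [/\ uniq s,
      forall x, x \in s <->
        [/\ best_approx xi x, (x.1 <= a)%N & (x.2 <= b)%N]
    & sorted best_le s].

Definition pairs_mx (R : realType) (N : nat) (s : N.-tuple (nat * nat)) :
    'M[R]_(2, N) :=
  \matrix_(i < 2, k < N)
    (if i == ord0 then (tnth s k).1 else (tnth s k).2)%:R.

(* T is the characteristic transformation T_alpha of alpha = p^a / q^b.  The
   irrationality of ln q / ln p is automatic for primes p < q, and the list s
   (hence N and T) is uniquely determined by p, q, a and b. *)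
Definition is_char_transf (R : realType) (p q a b : nat) (alpha : R)
    (N : nat) (T : {linear 'cV[R]_N -> 'cV[R]_2}) : Prop :=
  let xi : R := ln q%:R / ln p%:R in
  [/\ prime p, prime q, (p < q)%N, best_approx xi (a, b)
    & alpha = p%:R ^+ a / q%:R ^+ b] /\
  exists s : N.-tuple (nat * nat),
    is_best_list xi a b s /\ forall v : 'cV[R]_N, T v = pairs_mx R s *m v.

Definition fib_mx (R : realType) (n : nat) : 'M[R]_(2, n.+1) :=
  \matrix_(i < 2, k < n.+1) (if i == ord0 then fib k.+1 else fib k)%:R.

(* Main.v *)
(** For (ii), the numbers (-1)^k (h_{k+1} - h_k xi) satisfy a Fibonacci
    recursion running downwards, so positivity at k = n - 1 and k = n gives
    positivity for all k <= n: the pairs (h_{k+1}, h_k) lie alternately above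
    and below xi.  By Cassini's identity consecutive pairs form a unimodular
    basis, so a lattice point strictly between two consecutive directions
    dominates their sum; hence no pair with small entries is a better
    approximation than (h_{k+1}, h_k).

    For (i), if for some large prime p no prime q were to satisfy
    p^A < q < p^B, with A < B rational, then there would be at most p^A primes
    below p^B, which is fewer than Chebyshev's lower bound permits. *)

Require Import Defs.
From HB Require Import structures.
From mathcomp Require Import all_boot all_order all_algebra.
From mathcomp Require Import all_classical all_reals all_analysis.
From mathcomp Require Import zify ring lra.
Import Order.TTheory GRing.Theory Num.Theory.

Set Implicit Arguments.
Unset Strict Implicit.

(** * Chebyshev's lower bound and primes between powers *)

Lemma poly_le_exp2 (C E : nat) :
  exists l0, forall l, l0 <= l -> C * l.+1 ^ E <= 2 ^ l.
Proof.
elim: E C => [|E IH] C.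
  exists C => l Cl; rewrite expn0 muln1.
  exact: leq_trans Cl (ltnW (ltn_expl _ _)).
have [j0 Hj] := IH (C * 2 ^ E.+1); exists (j0.*2) => l l0.
have jl : j0 <= l./2 by lia.
(* One factor [(l./2).+1] is absorbed by [2 ^ l./2], the other [E] by the induction hypothesis at
   [l./2]. *)
apply: (@leq_trans (C * (2 * (l./2).+1) ^ E.+1)).
  by rewrite leq_mul2l leq_exp2r //; apply/orP; right; lia.
apply: (@leq_trans (2 ^ (l./2 + l./2))); last by rewrite leq_exp2l //; lia.
rewrite expnMn mulnA (expnS (l./2).+1) mulnCA expnD leq_mul ?Hj //.
exact: ltn_expl.
Qed.

Lemma exp2_le_central_bin (m : nat) : 2 ^ m <= 'C(m.*2, m).
Proof.
elim: m => // m IH; rewrite doubleS binS expnS mul2n -addnn.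
have H : 2 ^ m <= 'C(m.*2.+1, m.+1) by rewrite binS (leq_trans IH) ?leq_addl.
apply: leq_add => //; rewrite -bin_sub; last lia.
by have -> : m.*2.+1 - m = m.+1 by lia.
Qed.

Lemma central_bin_gt0 (m : nat) : 0 < 'C(m.*2, m).
Proof. by rewrite bin_gt0 -addnn leq_addr. Qed.

(** By Legendre's formula the exponent is the sum over [k] of [m.*2 %/ q ^ k - 2 * (m %/ q ^ k)];
    each term is at most 1 and vanishes once [q ^ k > m.*2]. *)
Lemma logn_central_bin (q m : nat) : prime q ->
  logn q 'C(m.*2, m) <= trunc_log q m.*2.
Proof.
move=> pq; have q1 := prime_gt1 pq; set t := trunc_log q m.*2.
have := congr1 (logn q) (@bin_fact m.*2 m ltac:(lia)).
have -> : m.*2 - m = m by lia.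
rewrite !lognM ?muln_gt0 ?fact_gt0 ?central_bin_gt0 // !logn_fact //.
have -> : \sum_(1 <= k < m.+1) m %/ q ^ k = \sum_(1 <= k < m.*2.+1) m %/ q ^ k.
  rewrite [RHS](@big_cat_nat _ _ _ m.+1) //=; last lia.
  rewrite [X in _ + X]big_nat_cond [X in _ + X]big1 ?addn0 // => k.
  move=> /andP[/andP[mk _] _]; apply: divn_small.
  exact: ltn_trans mk (ltn_expl _ q1).
have : \sum_(1 <= k < m.*2.+1) m.*2 %/ q ^ k <=
  \sum_(1 <= k < m.*2.+1) (m %/ q ^ k + m %/ q ^ k + (k <= t)).
  apply: leq_sum => k _; case: (leqP k t) => kt.
    have d0 : 0 < q ^ k by rewrite expn_gt0 ltnW.
    rewrite -[_ <= _]/(_ < _.+1) ltn_divLR //.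
    have := ltn_ceil m d0; set x := m %/ q ^ k; set d := q ^ k; nia.
  by rewrite divn_small // (leq_trans (trunc_log_ltn m.*2 q1)) // leq_exp2l.
have : \sum_(1 <= k < m.*2.+1) (k <= t : nat) <= t.
  elim: (m.*2) => [|j IH]; first by rewrite big_nil.
  rewrite big_nat_recr //=; case: (leqP j.+1 t) => jt; last by rewrite addn0.
  rewrite addn1; apply: leq_trans jt; rewrite ltnS big_add1 big_mkord.
  rewrite -[X in _ <= X]card_ord -sum1_card; apply: leq_sum => k _.
  exact: leq_b1.
rewrite !big_split /=; lia.
Qed.

(** Each prime power in the factorization is at most [m.*2], and at most [N] primes occur. *)
Lemma central_bin_le (m N : nat) : 0 < m ->
  (forall q, prime q -> q <= m.*2 -> q <= N) -> 'C(m.*2, m) <= m.*2 ^ N.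
Proof.
move=> m0 HN; have m20 : 0 < m.*2 by rewrite double_gt0.
have b0 := central_bin_gt0 m.
have pow_le q : prime q -> q ^ logn q 'C(m.*2, m) <= m.*2.
  move=> pq; apply: leq_trans (trunc_logP (prime_gt1 pq) m20).
  by rewrite leq_exp2l ?prime_gt1 ?logn_central_bin.
have memP q : q \in primes 'C(m.*2, m) -> prime q /\ q <= N.
  move=> qC; have pq : prime q by move: qC; rewrite mem_primes => /andP[].
  split=> //; apply: HN => //; apply: leq_trans (pow_le q pq).
  by rewrite -{1}(expn1 q) leq_exp2l ?prime_gt1 // logn_gt0.
rewrite [X in X <= _]prod_prime_decomp // prime_decompE big_map /= big_seq.
apply: (@leq_trans (\prod_(q <- primes 'C(m.*2, m)) m.*2)).
  rewrite [X in _ <= X]big_seq; apply: leq_prod => q qC; apply: pow_le.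
  by case: (memP q qC).
rewrite big_const_seq count_predT iter_muln_1 leq_pexp2l //.
rewrite -[X in _ <= X](size_iota 1 N).
apply: uniq_leq_size (primes_uniq _) _ => q qC.
by have [/prime_gt0 q0 qN] := memP q qC; rewrite mem_iota q0 add1n ltnS.
Qed.

(* If no prime fits, the primes up to [M ~ p^(c/d)] are all at most
   [N ~ p^(a/b)], a power of [M] with exponent less than 1; this contradicts
   Chebyshev's bound 2^m <= 'C(2m, m) <= (2m)^N for 2m ~ M. *)
Lemma prime_powers_between (a b c d : nat) :
  0 < b -> 0 < d -> a * d < b * c ->
  exists p q, [/\ prime p, prime q, p ^ a < q ^ b & q ^ d < p ^ c].
Proof.
move=> b0 d0 adbc; set E := b * c.
have c0 : 0 < c by case: (c) adbc; rewrite ?muln0.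
have E0 : 0 < E by rewrite muln_gt0 b0.
(* The factor [2 ^ (3 * E)] is the loss in the final estimate; the size of [p] serves to force
   [2 ^ l0.+2 <= M.+1]. *)
have [l0 Hl0] := poly_le_exp2 (2 ^ (3 * E)) E.
have [p pL pp] := prime_above (2 ^ (l0.+2 * d)).
have p1 := prime_gt1 pp; have p0 := ltnW p1.
apply: contrapT => no_q.
have le_expn x k : 0 < k -> x <= x ^ k.
  by case: k => // k _; case: x => // x; rewrite expnS leq_pmulr // expn_gt0.
have [|x|M Mlt Mmax] := @ex_maxnP [pred x | x ^ d < p ^ c] (p ^ c).
- by exists 0; rewrite /= exp0n // expn_gt0 p0.
- by move=> /= /ltnW; apply: leq_trans; exact: le_expn.
have [|x|N Nle Nmax] := @ex_maxnP [pred x | x ^ b <= p ^ a] (p ^ a).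
- by exists 0; rewrite /= exp0n.
- by move=> /=; apply: leq_trans; exact: le_expn.
move: Mlt Nle => /= Mlt Nle.
have Mge : p ^ c <= M.+1 ^ d.
  by rewrite leqNgt; apply/negP => /(Mmax M.+1); rewrite ltnn.
(* [N ^ (b * c) <= p ^ (a * c) <= M.+1 ^ (d * a)], and [a * d] is at most [E.-1]. *)
have NE : N ^ E <= M.+1 ^ E.-1.
  apply: (@leq_trans (M.+1 ^ (d * a))); last first.
    by rewrite leq_pexp2l // mulnC -ltnS prednK.
  rewrite /E !expnM.
  apply: (@leq_trans ((p ^ a) ^ c)); first by rewrite leq_exp2r.
  rewrite -expnM mulnC expnM; have [->|a0] := posnP a; first by rewrite !expn0.
  by rewrite leq_exp2r.
clearbody E.
have ML : 2 ^ l0.+2 <= M.+1.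
  rewrite -(leq_exp2r _ _ d0) -expnM (leq_trans (ltnW pL)) //.
  by rewrite (leq_trans _ Mge) // le_expn.
set l := trunc_log 2 M.+1.
have l0l : l0.+2 <= l by apply: trunc_log_max.
have lM : 2 ^ l <= M.+1 by apply: trunc_logP.
have Ml : M.+1 < 2 ^ l.+1 by apply: trunc_log_ltn.
have M3 : 3 <= M.
  by rewrite -ltnS (leq_trans _ ML) // (@leq_exp2l 2 2).
have m0 : 0 < M./2 by lia.
(* A prime [q] with [N < q <= M] would satisfy both required inequalities, so every prime up to [M]
   is at most [N]. *)
have mlN : M./2 <= l.+1 * N.
  rewrite -(@leq_exp2l 2) // expnM (leq_trans (exp2_le_central_bin _)) //.
  apply: (@leq_trans (M./2.*2 ^ N)).
    apply: central_bin_le => // q pq qM; apply: Nmax => /=.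
    rewrite leqNgt; apply/negP => qa; apply: no_q; exists p, q; split=> //.
    by apply: leq_ltn_trans Mlt; rewrite leq_exp2r //; lia.
  have [->|N0] := posnP N; first by rewrite !expn0.
  by rewrite leq_exp2r //; lia.
have : (2 ^ l) ^ E <= (2 ^ 2 * (l.+1 * N)) ^ E by rewrite leq_exp2r //; lia.
rewrite (expnMn (2 ^ 2)) (expnMn l.+1) => lE.
have : 2 ^ l < 2 ^ (3 * E) * l.+1 ^ E.
  (* After this multiplication the bound for the left side carries exactly one factor 2 less than
     the right side. *)
  rewrite -(@ltn_pmul2l ((2 ^ l) ^ E)) ?expn_gt0 //.
  apply: (@leq_ltn_trans
    ((2 ^ 2) ^ E * (l.+1 ^ E * (2 ^ l.+1) ^ E.-1) * 2 ^ l)).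
    rewrite leq_mul2r; apply/orP; right; apply: leq_trans lE _.

    rewrite leq_mul2l; apply/orP; right; rewrite leq_mul2l; apply/orP; right.
    apply: leq_trans NE _; case: (E.-1) => [|e]; first by rewrite !expn0.
    by rewrite leq_exp2r // ltnW.
  have {}lE : 0 < l.+1 ^ E by rewrite expn_gt0.
  have -> : (2 ^ 2) ^ E * (l.+1 ^ E * (2 ^ l.+1) ^ E.-1) * 2 ^ l =
            l.+1 ^ E * 2 ^ (2 * E + l.+1 * E.-1 + l).
    by rewrite -!expnM (expnD 2 (_ + _)) (expnD 2 (2 * E)) -!mulnA mulnCA.
  have -> : (2 ^ l) ^ E * (2 ^ (3 * E) * l.+1 ^ E) =
            l.+1 ^ E * 2 ^ (l * E + 3 * E).
    by rewrite -expnM (expnD 2 (l * E)) mulnA mulnC.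
  by rewrite ltn_pmul2l ?expn_gt0 // ltn_exp2l //; nia.
by rewrite ltnNge Hl0 //; lia.
Qed.

Local Open Scope ring_scope.

Arguments fib : simpl never.

(** * Fibonacci identities and lattice cones *)

Lemma fibSS k : fib k.+2 = (fib k.+1 + fib k)%N.
Proof. by []. Qed.

Lemma fib_gt0 k : (0 < fib k.+1)%N.
Proof. by elim: k => // k IH; rewrite fibSS addn_gt0 IH. Qed.

Lemma leq_fib : {homo fib : m n / (m <= n)%N}.
Proof.
apply: homo_leq; [exact: leqnn | exact: leq_trans | case=> // k].
by rewrite fibSS leq_addr.
Qed.

Lemma coprime_fib k : coprime (fib k.+1) (fib k).
Proof.
elim: k => // k IH; by rewrite fibSS /coprime gcdnC gcdnDl.
Qed.

(** The sign (-1)^k is split into two booleans to avoid subtraction in [nat]. *)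
Lemma cassini k :
  (fib k.+1 * fib k.+1 + odd k = fib k * fib k.+2 + ~~ odd k)%N.
Proof.
elim: k => // k IH; rewrite !fibSS; move: IH; rewrite fibSS oddS negbK.
move: (fib k.+1) (fib k) (odd k) => y x e; nia.
Qed.

Lemma coprime_cross_eq (a b c d : nat) : coprime a b -> coprime c d ->
  (a * d = c * b)%N -> (a, b) = (c, d).
Proof.
move=> ab cd E; congr (_, _); apply/eqP; rewrite eqn_dvd.
  rewrite -(Gauss_dvdl c ab) -E dvdn_mulr //=.
  by rewrite -(Gauss_dvdl a cd) E dvdn_mulr.
rewrite coprime_sym in ab; rewrite coprime_sym in cd.
rewrite -(Gauss_dvdr d ab) E dvdn_mull //=.
by rewrite -(Gauss_dvdr b cd) -E dvdn_mull.
Qed.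

(* A lattice point strictly inside the cone spanned by the unimodular basis
   [u, v] is [s u + t v] with integers s, t >= 1. *)
Lemma unimodular_cone (u1 u2 v1 v2 a b : nat) : (u1 * v2 = u2 * v1 + 1)%N ->
  (a * u2 < b * u1)%N -> (b * v1 < a * v2)%N ->
  (u1 + v1 <= a)%N /\ (u2 + v2 <= b)%N.
Proof.
move=> uv au bv.
(* Cramer's rule; the strict inequalities make the truncated subtractions exact. *)
pose s := (a * v2 - b * v1)%N; pose t := (b * u1 - a * u2)%N.
have s0 : (0 < s)%N by rewrite subn_gt0.
have t0 : (0 < t)%N by rewrite subn_gt0.
have -> : a = (s * u1 + t * v1)%N.
  have /(congr1 (muln a)) := uv; rewrite /s /t !mulnBl; nia.
have -> : b = (s * u2 + t * v2)%N.
  have /(congr1 (muln b)) := uv; rewrite /s /t !mulnBl; nia.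
by split; apply: leq_add; apply: leq_pmull.
Qed.

(** * Best approximations to [xi] *)

Section BestApproximations.
Variables (R : realType) (xi : R).

(** Cross-multiplication also covers the value +oo, since in [calN] a zero second entry forces a
    nonzero first one. *)
Lemma le_quot (x y : nat * nat) : calN x -> calN y ->
  (quot R x <= quot R y)%E = (x.1 * y.2 <= y.1 * x.2)%N.
Proof.
case: x y => [a b] [c d]; rewrite /calN /quot /= => ab cd.
case: (posnP b) => [b0|b0].
  rewrite b0 muln0 leqn0 muln_eq0; case: (posnP d) => d0.
    by rewrite lexx orbT.
  rewrite orbF leye_eq /=; apply/esym/eqP => a0.
  by apply: ab; rewrite a0 b0.
case: (posnP d) => [->|d0]; first by rewrite muln0 leey.
rewrite lee_fin ler_pdivrMr ?ltr0n // mulrAC ler_pdivlMr ?ltr0n //.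
by rewrite -!natrM ler_nat.
Qed.

Lemma calU1E (x : nat * nat) : calU1 xi x <-> calU xi x /\
  forall y, calU xi y -> (y.1 <= x.1)%N -> (x.1 * y.2 <= y.1 * x.2)%N.
Proof.
split=> -[xU H]; split=> //; first move=> y yU yx.
- by rewrite -le_quot; [apply: H.2; exists y|case: xU|case: yU].
split; first by exists x.
by move=> _ [y [yU yx] <-]; rewrite le_quot; [exact: H|case: xU|case: yU].
Qed.

Lemma calL2E (x : nat * nat) : calL2 xi x <-> calL xi x /\
  forall y, calL xi y -> (y.2 <= x.2)%N -> (y.1 * x.2 <= x.1 * y.2)%N.
Proof.
split=> -[xL H]; split=> //; first move=> y yL yx.
- by rewrite -le_quot; [apply: H.2; exists y|case: yL|case: xL].
split; first by exists x.
by move=> _ [y [yL yx] <-]; rewrite le_quot; [exact: H|case: yL|case: xL].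
Qed.

Lemma fib_sign_alternates n :
  let e k := (-1) ^+ k * ((fib k.+1)%:R - (fib k)%:R * xi) in
  0 < e n -> 0 < e n.+1 -> forall k, (k <= n.+1)%N -> 0 < e k.
Proof.
move=> e; elim: n => [|n IH] e0 e1 k.
  by case: k => [|[|]].
rewrite leq_eqVlt => /orP[/eqP->//|]; rewrite ltnS; apply: IH => //.
(* The alternating sign reverses the Fibonacci recursion. *)
have -> : e n = e n.+1 + e n.+2; last by rewrite addr_gt0.
rewrite /e !fibSS !natrD !exprS; ring.
Qed.

Variable n : nat.
Hypotheses (n_gt0 : (0 < n)%N) (n_even : ~~ odd n).
Hypothesis xi_gt : (fib n)%:R < (fib n.-1)%:R * xi.
Hypothesis xi_lt : (fib n)%:R * xi < (fib n.+1)%:R.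

Let sgn k : (k <= n)%N ->
  0 < (-1) ^+ k * ((fib k.+1)%:R - (fib k)%:R * xi).
Proof.
case: n n_gt0 n_even xi_gt xi_lt => // m _ /= m_odd h1 h2.
apply: fib_sign_alternates; rewrite -signr_odd /= ?m_odd.
  by rewrite (negbNE m_odd) expr1; lra.
by rewrite (negbTE m_odd) expr0; lra.
Qed.

Lemma fib_odd_lt_xi k : odd k -> (k <= n)%N ->
  (fib k.+1)%:R < (fib k)%:R * xi.
Proof. by move=> ok /sgn; rewrite -signr_odd ok expr1; lra. Qed.

Lemma fib_even_gt_xi k : ~~ odd k -> (k <= n)%N ->
  (fib k)%:R * xi < (fib k.+1)%:R.
Proof. by move=> ok /sgn; rewrite -signr_odd (negbTE ok) expr0; lra. Qed.

Lemma calU_fib k : ~~ odd k -> (k <= n)%N -> calU xi (fib k.+1, fib k).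
Proof.
move=> ok kn; split; last exact: fib_even_gt_xi.
by have := fib_gt0 k; rewrite /calN /=; case: (fib k.+1).
Qed.

Lemma calL_fib k : odd k -> (k <= n)%N -> calL xi (fib k.+1, fib k).
Proof.
move=> ok kn; split; last exact: fib_odd_lt_xi.
by have := fib_gt0 k; rewrite /calN /=; case: (fib k.+1).
Qed.

Lemma calU_gt_fib a b k : calU xi (a, b) -> odd k -> (k <= n)%N ->
  (b * fib k.+1 < a * fib k)%N.
Proof.
move=> [_ /= abU] ok kn; have := fib_odd_lt_xi ok kn.
have f0 : 0 < (fib k)%:R :> R.
  by rewrite ltr0n; case: (k) ok => // j _; exact: fib_gt0.
have b0 : 0 <= b%:R :> R by [].
rewrite -(ltr_nat R) !natrM; nra.
Qed.

Lemma calL_lt_fib a b k : calL xi (a, b) -> ~~ odd k -> (k <= n)%N ->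
  (a * fib k < b * fib k.+1)%N.
Proof.
move=> [_ /= abL] ok kn; have := fib_even_gt_xi ok kn.
have f0 : 0 <= (fib k)%:R :> R by [].
have b0 : 0 < b%:R :> R.
  rewrite ltr0n lt0n; apply/eqP => b0.
  by move: abL; rewrite b0 mul0r ltNge ler0n.
rewrite -(ltr_nat R) !natrM; nra.
Qed.

(** A better competitor lies above [xi], hence inside the cone of pair [k] and a neighbouring
    odd-indexed pair, which makes its first entry exceed [fib k.+1]. *)
Lemma upper_best_fib k : ~~ odd k -> (k <= n)%N ->
  upper_best_approx xi (fib k.+1, fib k).
Proof.
move=> ok kn; have kU := calU_fib ok kn.
split; first by split; [case: kU | exact/eqP/coprime_fib].
apply/calU1E; split=> // -[a b] /= abU ak; rewrite leqNgt; apply/negP => lt_k.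
(* For [k = n] the hypotheses do not place the pair of index [n.+1] below [xi], so the cone uses
   index [n.-1] instead. *)
move: (kn); rewrite leq_eqVlt => /orP[/eqP en|ltkn].
  have om : odd n.-1 by move: n_even; rewrite -{1}(prednK n_gt0) /= negbK.
  have := cassini n.-1; rewrite prednK // om => C.
  have [] := @unimodular_cone (fib n.+1) (fib n) (fib n) (fib n.-1) a b.
  - lia.
  - by rewrite -en; lia.
  - have := @calU_gt_fib a b n.-1 abU; rewrite prednK //; apply=> //; lia.
  - move=> h _; have : (fib k.+1 + fib k <= fib k.+1)%N.
      by rewrite en (leq_trans h) // -en.
    have : (0 < fib k)%N by rewrite en -(prednK n_gt0) fib_gt0.
    lia.
have [] := @unimodular_cone (fib k.+1) (fib k) (fib k.+2) (fib k.+1) a b.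
- by have := cassini k; rewrite (negbTE ok); lia.
- lia.
- by apply: calU_gt_fib.
- by have := fib_gt0 k.+1; lia.
Qed.

Lemma lower_best_fib k : odd k -> (k <= n)%N ->
  lower_best_approx xi (fib k.+1, fib k).
Proof.
move=> ok kn; have kL := calL_fib ok kn.
(* Parity excludes [k = n], so the pair of index [k.+1] is known to lie above [xi]. *)
have {}kn : (k < n)%N.
  by rewrite ltn_neqAle kn andbT; apply: contraNneq n_even => <-.
split; first by split; [case: kL | exact/eqP/coprime_fib].
apply/calL2E; split=> // -[a b] /= abL bk; rewrite leqNgt; apply/negP => lt_k.
have [] := @unimodular_cone (fib k.+2) (fib k.+1) (fib k.+1) (fib k) a b.
- by have := cassini k; rewrite ok; lia.
- by apply: calL_lt_fib => //=; rewrite negbK.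
- by rewrite mulnC.
- by have := fib_gt0 k; lia.
Qed.

(** Take the largest even [k <= n] with [fib k.+1 <= a]. If the quotients differed for [k < n], the
    cone would give [fib k.+3 <= a], against maximality; for [k = n] the size bounds decide. *)
Lemma upper_best_is_fib a b : upper_best_approx xi (a, b) ->
  (a <= fib n.+1)%N -> (b <= fib n)%N ->
  exists2 k, (k <= n)%N & (a, b) = (fib k.+1, fib k).
Proof.
move=> [[_ /= /eqP ab] /calU1E[abU abmin]] an bn.
have a0 : (0 < a)%N.
  rewrite lt0n; apply/eqP => a0; case: (abU) => _ /=; rewrite a0 ltNge.
  have := fib_odd_lt_xi (k := 1%N) isT ltac:(lia); rewrite mul1r => xi0.
  by rewrite mulr_ge0 // (le_trans _ (ltW xi0)).
have [|k /and3P[_ kn _]//|k /and3P[ok kn ka] kmax] :=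
  @ex_maxnP [pred k | [&& ~~ odd k, k <= n & fib k.+1 <= a]%N] n.
  by exists 0%N => /=.
exists k => //; apply: coprime_cross_eq => //; first exact: coprime_fib.
have := abmin _ (calU_fib ok kn) ka => /= le_k.
move: (kn); rewrite leq_eqVlt => /orP[/eqP En|ltkn].
  move: ka le_k; rewrite En => ka.
  have -> : a = fib n.+1 by lia.
  by rewrite leq_pmul2l ?fib_gt0 // => le_n; congr muln; lia.
apply/eqP; rewrite eqn_leq le_k leqNgt; apply/negP.
rewrite [X in (_ < X)%N]mulnC => lt_k.
have [] := @unimodular_cone (fib k.+1) (fib k) (fib k.+2) (fib k.+1) a b.
- by have := cassini k; rewrite (negbTE ok); lia.
- by [].
- by apply: calU_gt_fib.
- rewrite addnC => h _.
  have k2n : (k.+2 <= n)%N.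
    rewrite ltn_neqAle ltkn andbT; apply: contraNneq n_even => <- /=.
    by rewrite ok.
  have /= := kmax k.+2; rewrite negbK ok k2n /= => /(_ h); lia.
Qed.

(** Dual argument, with the largest odd [k <= n] such that [fib k <= b]. *)
Lemma lower_best_is_fib a b : lower_best_approx xi (a, b) ->
  (b <= fib n)%N ->
  exists2 k, (k <= n)%N & (a, b) = (fib k.+1, fib k).
Proof.
move=> [[_ /= /eqP ab] /calL2E[abL abmax]] bn.
have b0 : (0 < b)%N.
  rewrite lt0n; apply/eqP => b0; case: (abL) => _ /=.
  by rewrite b0 mul0r ltNge ler0n.
have [|k /and3P[_ kn _]//|k /and3P[ok kn kb] kmax] :=
  @ex_maxnP [pred k | [&& odd k, k <= n & fib k <= b]%N] n.
  by exists 1%N; rewrite /= n_gt0.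
exists k => //; apply: coprime_cross_eq => //; first exact: coprime_fib.
have := abmax _ (calL_fib ok kn) kb => /= le_k.
have {}kn : (k < n)%N.
  by rewrite ltn_neqAle kn andbT; apply: contraNneq n_even => <-.
apply/eqP; rewrite eqn_leq le_k andbT leqNgt; apply/negP => lt_k.
have [] := @unimodular_cone (fib k.+2) (fib k.+1) (fib k.+1) (fib k) a b.
- by have := cassini k; rewrite ok; lia.
- by apply: calL_lt_fib => //=; rewrite negbK.
- by rewrite mulnC.
move=> _ h; case: (ltnP k.+1 n) => kn'.
  by have /= := kmax k.+2; rewrite negbK ok kn' /= => /(_ h); lia.
(* Now [k.+2] is out of range, but [b >= fib n + fib k] already violates [b <= fib n]. *)
have En : n = k.+1 by lia.
have : (0 < fib k)%N by case: (k) ok => // j _; exact: fib_gt0.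
by move: h bn; rewrite En; lia.
Qed.

Lemma best_approx_fib (x : nat * nat) :
  [/\ best_approx xi x, (x.1 <= fib n.+1)%N & (x.2 <= fib n)%N] <->
  exists2 k, (k <= n)%N & x = (fib k.+1, fib k).
Proof.
case: x => a b; split=> [[/= [abU|abL] an bn]|[k kn ->]].
- exact: upper_best_is_fib.
- exact: lower_best_is_fib.
- split; [|exact: leq_fib|exact: leq_fib].
  case: (boolP (odd k)) => ok; first by right; exact: lower_best_fib.
  by left; exact: upper_best_fib.
Qed.


Lemma fib_best_list :
  is_best_list xi (fib n.+1) (fib n) [seq (fib k.+1, fib k) | k <- iota 0 n.+1].
Proof.
split.
- rewrite map_inj_in_uniq ?iota_uniq // => j k _ _ [E1 E2].
  (* [fib] repeats the value 1, whereas its shift by 2 is strictly increasing. *)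
  have : fib j.+2 = fib k.+2 by rewrite !fibSS E1 E2.
  have lt_fib : {homo (fun i => fib i.+2) : i l / (i < l)%N}.
    apply: homo_ltn => [? ? ?|i]; first exact: ltn_trans.
    by have := fib_gt0 i; rewrite !fibSS; lia.
  by case: (ltngtP j k) => // /lt_fib lt_jk E; move: lt_jk; rewrite E ltnn.
- move=> x; apply: iff_sym; apply: iff_trans (best_approx_fib x) _.
  split=> [[k kn ->]|/mapP[k]]; last by rewrite mem_iota => /= kn ->; exists k.
  by apply: map_f; rewrite mem_iota.
- rewrite sorted_map; apply: sub_sorted (iota_sorted 0 n.+1) => j k /= jk.
  by rewrite /best_le /= leq_fib //= leq_fib ?ltnS ?jk // implybT.
Qed.

End BestApproximations.

(** * Passage to logarithms and the matrix of [T_alpha] *)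

Unset Implicit Arguments.
Set Strict Implicit.

Theorem theorem4p4 (R : realType) (n : nat) (n_gt0 : (0 < n)%N)
    (n_even : ~~ odd n) :
  (exists p q : nat,
    [/\ prime p, prime q,
        (fib n)%:R / (fib n.-1)%:R < ln q%:R / ln p%:R :> R
      & ln q%:R / ln p%:R < (fib n.+1)%:R / (fib n)%:R :> R]) /\
  (forall (p q : nat) (alpha : R), prime p -> prime q ->
    (fib n)%:R / (fib n.-1)%:R < ln q%:R / ln p%:R :> R ->
    ln q%:R / ln p%:R < (fib n.+1)%:R / (fib n)%:R :> R ->
    alpha = p%:R ^+ fib n.+1 / q%:R ^+ fib n ->
    is_char_transf p q (fib n.+1) (fib n) alpha (mulmx (fib_mx R n))).
Proof.
have om : odd n.-1 by move: n_even; rewrite -{1}(prednK n_gt0) /= negbK.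
have fn1_gt0 : (0 < fib n.-1)%N.
  by case: (n.-1) om => // m _; exact: fib_gt0.
have fn_gt0 : (0 < fib n)%N by rewrite -(prednK n_gt0) fib_gt0.
have ln_gt0 p : prime p -> 0 < ln p%:R :> R.
  by move=> /prime_gt1 p1; apply: ln_gt0; rewrite ltr1n.
split=> [|p q alpha pp pq].
  have [p [q [pp pq pq1 pq2]]] : exists p q, [/\ prime p, prime q,
      (p ^ fib n < q ^ fib n.-1)%N & (q ^ fib n < p ^ fib n.+1)%N].
    (* The condition on the exponents is Cassini's identity at the odd index [n.-1]. *)
    apply: prime_powers_between => //.
    by have := cassini n.-1; rewrite om prednK //=; lia.
  have ltln a b c d : prime a -> prime b -> (a ^ c < b ^ d)%N ->
      ln a%:R * c%:R < ln b%:R * d%:R :> R.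
    move=> /prime_gt0 a0 /prime_gt0 b0 lt_ab.
    rewrite !mulr_natr -!lnXn ?ltr0n // -!natrX ltr_ln ?ltr_nat //.
      by rewrite posrE ltr0n expn_gt0 a0.
    by rewrite posrE ltr0n expn_gt0 b0.
  exists p, q; split=> //.
    rewrite ltr_pdivrMr ?ltr0n // mulrAC ltr_pdivlMr ?ln_gt0 // mulrC.
    exact: ltln.
  rewrite ltr_pdivrMr ?ln_gt0 // mulrAC ltr_pdivlMr ?ltr0n // [X in _ < X]mulrC.
  exact: ltln.
set xi := ln q%:R / ln p%:R => xi_gt xi_lt alphaE.
have {}xi_gt : (fib n)%:R < (fib n.-1)%:R * xi.
  by move: xi_gt; rewrite ltr_pdivrMr ?ltr0n // mulrC.
have {}xi_lt : (fib n)%:R * xi < (fib n.+1)%:R.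
  by move: xi_lt; rewrite ltr_pdivlMr ?ltr0n // mulrC.
split; first split=> //.
(* The pair of index 1 is (1, 1); its position below [xi] yields [p < q]. *)
- have : 1 < xi.
    have /(fib_odd_lt_xi n_gt0 n_even xi_gt xi_lt) : odd 1 by [].
    by move=> /(_ n_gt0); rewrite mul1r.
  rewrite ltr_pdivlMr ?ln_gt0 // mul1r ltr_ln ?posrE ?ltr0n ?prime_gt0 //.
  by rewrite ltr_nat.
- left; exact: (upper_best_fib n_gt0 n_even xi_gt xi_lt n_even (leqnn n)).
have sz : size [seq (fib k.+1, fib k) | k <- iota 0 n.+1] == n.+1.
  by rewrite size_map size_iota.
exists (Tuple sz); split; first exact: fib_best_list.
move=> v; congr (_ *m v); apply/matrixP => i k; rewrite !mxE.
suff -> : tnth (Tuple sz) k = (fib k.+1, fib k) by [].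
transitivity (nth (0, 0)%N [seq (fib j.+1, fib j) | j <- iota 0 n.+1] k).
  exact: tnth_nth.
by rewrite (nth_map 0%N) ?size_iota // nth_iota.
Qed.
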